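(* Let $\Omega$ be a perfectly normal topological space and let $A$ be a non-empty $G_\delta$-subset of $\Omega$. Then every function $f\in\mathscr{B}_1(A)$ has an extension $\overline{f}\in\mathscr{B}_1(\Omega)$ such that $\|f\|_\infty=\|\overline{f}\|_\infty$. More exactly, if $\sup_{x\in A}|f(x)|=c<\infty$, then there exists a sequence $(H_n)_{n=0}^\infty$ of subsets of $\Omega$, each of which is both an $F_\sigma$- and a $G_\delta$-subset of $\Omega$, such that the function $$\overline{f}(x):=c\cdot\sum_{n=0}^\infty\left(\frac{2}{3}\right)^{n+1}\left(\frac{1}{2}-\chi_{H_n}(x)\right),\qquad x\in\Omega,$$ (the series converging uniformly on $\Omega$) extends $f$ and satisfies $\sup_{x\in\Omega}|\overline{f}(x)|=c$.
   Context: For a topological space $X$, $\mathscr{B}_1(X)$ denotes the space of all functions $X\to\mathbb{R}$ of the first Baire class, i.e. pointwise limits of sequences of continuous real-valued functions on $X$. A subset $A\subset\Omega$ carries the subspace topology. $\|\cdot\|_\infty$ is the supremum norm over the domain of the function (possibly $\infty$, since $f$ is not assumed bounded in the first part). $\chi_H$ is the characteristic function of $H\subset\Omega$. $F_\sigma$-sets are countable unions of closed sets; $G_\delta$-sets are countable intersections of open sets. *)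

(* Defs.v *)
From mathcomp Require Import all_boot all_order all_algebra.
From mathcomp Require Import all_classical all_reals all_analysis.
From mathcomp Require Import borel_hierarchy.

Set Implicit Arguments.
Unset Strict Implicit.
Unset Printing Implicit Defensive.

Import Order.TTheory GRing.Theory Num.Theory.
Import numFieldNormedType.Exports.

Local Open Scope classical_set_scope.
Local Open Scope ring_scope.

(* No T1 or Hausdorff axiom is included: authors differ on whether "normal"
   contains one. *)
Definition perfectly_normal_space (T : topologicalType) : Prop :=
  normal_space T /\ forall C : set T, closed C -> Gdelta C.

Definition baire_one (R : realType) (T : topologicalType) (f : T -> R) : Prop :=
  exists2 u : nat -> T -> R,
    (forall n, continuous (u n)) & (forall x, u n x @[n --> \oo] --> f x).

(* The supremum is taken in the extended reals, so that, for nonempty T, it is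
   +oo exactly when f is unbounded. *)
Definition sup_norm (R : realType) (T : Type) (f : T -> R) : \bar R :=
  ereal_sup (range (fun x => `|f x|%:E)).

(* Main.v *)
Require Import Defs.
From mathcomp Require Import all_boot all_order all_algebra.
From mathcomp Require Import all_classical all_reals all_analysis.
From mathcomp Require Import borel_hierarchy.
From mathcomp Require Import ring lra.

Set Implicit Arguments.
Unset Strict Implicit.
Unset Printing Implicit Defensive.

Import Order.TTheory GRing.Theory Num.Theory.
Import numFieldNormedType.Exports.

Local Open Scope classical_set_scope.
Local Open Scope ring_scope.

(* A Baire-one function on the G_delta-set [A] has its level sets {f >= a} and
   {f <= a} of type G_delta in the whole space, and in a perfectly normal space
   disjoint G_delta-sets are separated by a set that is both F_sigma and
   G_delta. If |g| <= c on [A] and [H] separates {g <= -c/3} from {g >= c/3},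
   then subtracting (2c/3)(1/2 - chi_H) from [g] leaves a remainder bounded by
   2c/3 on [A], with level sets of the same type; iterating gives the series. *)

(** * Closure properties of G_delta- and F_sigma-sets *)

Lemma Gdelta_setC (T : topologicalType) (S : set T) :
  Gdelta (~` S) <-> Fsigma S.
Proof.
split=> -[F oF SE].
  exists (fun i => ~` F i) => [i|]; first exact: open_closedC.
  by rewrite -setC_bigcap -SE setCK.
exists (fun i => ~` F i) => [i|]; first exact: closed_openC.
by rewrite SE setC_bigcup.
Qed.

Lemma Gdelta_setI (T : topologicalType) (S U : set T) :
  Gdelta S -> Gdelta U -> Gdelta (S `&` U).
Proof.
move=> [F oF ->] [G oG ->]; exists (fun i => F i `&` G i) => [i|].
  exact: openI.
by rewrite bigcapI.
Qed.

Lemma Gdelta_bigcap (T : topologicalType) (F : nat -> set T) :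
  (forall i, Gdelta (F i)) -> Gdelta (\bigcap_i F i).
Proof.
move=> GF.
have /choice[G GP] i : exists G : nat -> set T,
    (forall j, open (G j)) /\ F i = \bigcap_j G j.
  by have [G oG FE] := GF i; exists G.
(* The pairs [(i, j)] are enumerated by their codes; a number that codes no pair contributes [setT],
   neutral for intersections. *)
exists (fun n => if unpickle n is Some (i, j) then G i j else setT) => [n|].
  by case: (unpickle n) => [[i j]|]; [have [] := GP i | exact: openT].
apply/seteqP; split=> [x Fx n _|x Gx i _].
  case: (unpickle n) => [[i j]|//].
  by have := Fx i I; rewrite (GP i).2; exact.
rewrite (GP i).2 => j _.
by have := Gx (pickle (i, j)) I; rewrite pickleK.
Qed.

Lemma Gdelta_setU (T : topologicalType) (S U : set T) :
  Gdelta S -> Gdelta U -> Gdelta (S `|` U).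
Proof.
move=> [F oF ->] [G oG ->].
rewrite setU_bigcapl; apply: Gdelta_bigcap => i.
by exists (fun j => F i `|` G j) => [j|]; [exact: openU|rewrite setU_bigcapr].
Qed.

(** Open sets of the subspace are traces of open sets [G i], so the image is the intersection of [A]
    with all [G i]; here [A] has to be G_delta. *)
Lemma Gdelta_set_val (T : topologicalType) (A : set T) (S : set A) :
  Gdelta A -> Gdelta S -> Gdelta (set_val @` S).
Proof.
move=> GA [F oF ->].
have /choice[G GP] i : exists G : set T, open G /\ set_val @^-1` G = F i.
  by have [G oG GE] := oF i; exists G.
rewrite (_ : _ @` _ = A `&` \bigcap_i G i).
  by apply: Gdelta_setI => //; exists G => // i; have [] := GP i.
apply/seteqP; split=> [_ [x Fx <-]|x [Ax Gx]].
  split=> [|i _]; first exact: set_valP.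
  by have := Fx i I; rewrite -(GP i).2.
exists (SigSub (mem_set Ax)) => // i _.
by rewrite -(GP i).2; exact: Gx.
Qed.

(** * Reduction and separation in perfectly normal spaces *)

Lemma perfectly_normal_Fsigma (T : topologicalType) (O C : set T) :
  perfectly_normal_space T -> open O -> closed C -> Fsigma (C `&` O).
Proof.
move=> [_ pT] oO cC.
have /Gdelta_setC[F cF ->] : Gdelta (~` O) by apply: pT; exact: open_closedC.
rewrite setI_bigcupr; exists (fun i => C `&` F i) => // i.
exact: closedI.
Qed.

Lemma Fsigma_bigcup (T : topologicalType) (F : nat -> set T) :
  (forall i, Fsigma (F i)) -> Fsigma (\bigcup_i F i).
Proof.
move=> FF; apply/Gdelta_setC; rewrite setC_bigcup; apply: Gdelta_bigcap => i.
exact/Gdelta_setC.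
Qed.

(* Each point is allotted to [H] or to its complement according to whether a
   member of [G] or a member of [F] contains it first. *)
Lemma Fsigma_reduction (T : topologicalType) (P Q : set T) :
  perfectly_normal_space T -> Fsigma P -> Fsigma Q -> P `|` Q = setT ->
  exists H : set T, [/\ Fsigma H, Gdelta H, ~` P `<=` H & H `<=` Q].
Proof.
move=> pT [F cF PE] [G cG QE] PQT.
have FD (C E : nat -> set T) n k : (forall i, closed (C i)) ->
    (forall i, closed (E i)) -> Fsigma (C n `\` \bigcup_(m in `I_k) E m).
  move=> cC cE; apply: perfectly_normal_Fsigma => //; apply: closed_openC.
  exact: closed_bigcup.
pose H := \bigcup_n (G n `\` \bigcup_(m in `I_n) F m).
(* A tie between [F] and [G] is decided in favour of [H], hence ['I_n] above but ['I_n.+1] here. *)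
have HC : ~` H = \bigcup_n (F n `\` \bigcup_(m in `I_n.+1) G m).
  apply/seteqP; split=> [x nHx|x [n _ [Fx nGx]] [m _ [Gx nFx]]]; last first.
    by case: (ltnP n m) => nm; [apply: nFx; exists n|apply: nGx; exists m].
  (* At the least index where [F] or [G] contains [x], it cannot be [G], since [x] would then lie in
     [H]. *)
  have exn : exists n, `[< F n x \/ G n x >].
    have : (P `|` Q) x by rewrite PQT.
    by rewrite PE QE => -[[n _ ?]|[n _ ?]]; exists n; apply/asboolP; tauto.
  have [n /asboolP FGx nmin] := ex_minnP exn.
  have nFG m : (m < n)%N -> ~ (F m x \/ G m x).
    by move=> mn /asboolP/nmin; rewrite leqNgt mn.
  have nGx : ~ G n x.
    move=> Gx; apply: nHx; exists n => //; split=> // -[m mn Fx].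
    by apply: (nFG m mn); left.
  exists n => //; split=> [|[m /=]]; first by case: FGx.
  by rewrite ltnS leq_eqVlt => /predU1P[-> //|/nFG] /not_orP[].
exists H; split.
- by apply: Fsigma_bigcup => n; exact: FD.
- rewrite -[H]setCK; apply/Gdelta_setC; rewrite HC.
  by apply: Fsigma_bigcup => n; exact: FD.
- move=> x; apply: contra_notP; rewrite -[~ H x]/((~` H) x) HC PE.
  by move=> [n _ [Fx _]]; exists n.
- by move=> x [n _ [Gx _]]; rewrite QE; exists n.
Qed.

(** Reduction applied to the complements: they are F_sigma, and they cover the space because [P] and
    [Q] are disjoint. *)
Lemma Gdelta_separation (T : topologicalType) (P Q : set T) :
  perfectly_normal_space T -> Gdelta P -> Gdelta Q -> P `&` Q = set0 ->
  exists H : set T, [/\ Fsigma H, Gdelta H, P `<=` H & H `<=` ~` Q].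
Proof.
move=> pT GP GQ PQ0; rewrite -{1}(setCK P).
apply: Fsigma_reduction => //; try by apply/Gdelta_setC; rewrite setCK.
by rewrite -setCI PQ0 setC0.
Qed.

(** * Baire-one functions: level sets and characteristic functions *)

Lemma baire_one_ge_Gdelta (R : realType) (T : topologicalType) (g : T -> R)
    (a : R) : baire_one g -> Gdelta [set x | a <= g x].
Proof.
move=> [u cu ug].
(* As [u n x] converges to [g x], [a <= g x] means that for each [N] some [n >= N] has
   [u n x > a - 1/(N+1)], an open condition. *)
exists (fun N => \bigcup_(n in [set n | (N <= n)%N])
                   u n @^-1` [set y | a - N.+1%:R^-1 < y]) => [N|].
  apply: bigcup_open => n _; apply: open_comp => [x _|]; first exact: cu.
  exact: open_gt.
apply/seteqP; split=> [x /= ag N _|x /= H].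
  have [|n _ nP] := cvgr_gt _ (ug x) (a - N.+1%:R^-1).
    by rewrite (lt_le_trans _ ag)// ltrBlDr ltrDl invr_gt0.
  exists (maxn N n); [exact: leq_maxl|apply: nP; exact: leq_maxr].
rewrite leNgt; apply/negP => ga.
(* Far out, [u m x] lies below the midpoint of [g x] and [a], while [H] at an index with 1/(N+1) <
   [e] puts some such [u m x] above it. *)
have e0 : 0 < (a - g x) / 2 by rewrite divr_gt0// subr_gt0.
set e := (a - g x) / 2 in e0.
have [|n _ nP] := cvgr_lt _ (ug x) (g x + e); first by rewrite ltrDl.
have [N _ NP] := near_infty_natSinv_lt (PosNum e0).
have [m /= Mm um] := H (maxn n N) I.
have := nP m (leq_trans (leq_maxl _ _) Mm).
have := NP (maxn n N) (leq_maxr _ _).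
by move: um => /=; rewrite /e; move: _^-1 => d; lra.
Qed.

Lemma baire_oneN (R : realType) (T : topologicalType) (g : T -> R) :
  baire_one g -> baire_one (\- g).
Proof.
move=> [u cu ug]; exists (fun n => \- u n) => [n x|x].
  by apply: cvgN; exact: cu.
by apply: cvgN; exact: ug.
Qed.

Lemma baire_one_le_Gdelta (R : realType) (T : topologicalType) (g : T -> R)
    (a : R) : baire_one g -> Gdelta [set x | g x <= a].
Proof.
move=> /baire_oneN/(@baire_one_ge_Gdelta _ _ _ (- a)).
by under eq_set do rewrite lerN2.
Qed.

(** Both [H] and its complement are countable unions of closed sets. A Urysohn function that is 1 on
    the first [n] pieces of [H] and 0 on the first [n] pieces of the complement is eventually
    correct at each point. *)
Lemma indic_baire_one (R : realType) (T : topologicalType) (H : set T) :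
  normal_space T -> Fsigma H -> Gdelta H ->
  exists w : nat -> T -> R, [/\ forall n, continuous (w n),
    forall n x, 0 <= w n x <= 1 &
    forall x, w n x @[n --> \oo] --> (\1_H x : R)].
Proof.
move=> nT [F cF HF] GH.
have [G cG HG] : Fsigma (~` H) by apply/Gdelta_setC; rewrite setCK.
have dFG m n : F m `&` G n = set0.
  apply/seteqP; split=> // x [Fx Gx].
  have : (~` H) x by rewrite HG; exists n.
  by apply; rewrite HF; exists m.
have cU (E : nat -> set T) n : (forall i, closed (E i)) ->
    closed (\bigcup_(m in `I_n) E m).
  by move=> cE; exact: closed_bigcup.
have /choice[w wP] n : exists w : T -> R, [/\ continuous w,
    w @` (\bigcup_(m in `I_n) G m) `<=` [set 0],
    w @` (\bigcup_(m in `I_n) F m) `<=` [set 1] & range w `<=` `[0, 1]].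
  apply: urysohn_ext_itv => //; try exact: cU.
  apply/seteqP; split=> // x [[i _ Gx] [j _ Fx]].
  by rewrite -(dFG j i).
exists w; split=> [n|n x|x]; first by have [] := wP n.
  have [_ _ _ w01] := wP n.
  by have := w01 (w n x) ltac:(by exists x); rewrite /= in_itv.
rewrite indicE; case: (pselect (H x)) => Hx.
  rewrite mem_set//; move: Hx; rewrite {1}HF => -[m _ Fx].
  apply: cvg_near_cst; exists m.+1 => // n /= mn.
  have [_ _ w1 _] := wP n; apply: w1; exists x => //; by exists m.
rewrite memNset//; have : (~` H) x by []. rewrite HG => -[m _ Gx].
apply: cvg_near_cst; exists m.+1 => // n /= mn.
have [_ w0 _ _] := wP n; apply: w0; exists x => //; by exists m.
Qed.

(** * Series with terms bounded by (2/3)^n / 3 *)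

Section geometric_two_thirds.
Variables (R : realType) (u : nat -> R).
Hypothesis u_le : forall n, `|u n| <= (2 / 3) ^+ n / 3.

(** The bound telescopes: (2/3)^n / 3 = (2/3)^n - (2/3)^(n+1). *)
Lemma series_two_thirds_dist N M : (N <= M)%N ->
  `|series u M - series u N| <= (2 / 3) ^+ N - (2 / 3) ^+ M.
Proof.
elim: M => [|M IH]; first by rewrite leqn0 => /eqP ->; rewrite !subrr normr0.
rewrite leq_eqVlt => /predU1P[->|]; first by rewrite !subrr normr0.
rewrite ltnS => /IH {}IH; rewrite seriesSr addrAC exprS.
by have := u_le M; have := ler_normD (series u M - series u N) (u M); lra.
Qed.

Lemma cvg_series_two_thirds : cvgn (series u).
Proof.
apply: normed_cvg; apply: (@series_le_cvg _ _ (geometric (1 / 3) (2 / 3))).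
- by move=> n; exact: normr_ge0.
- by move=> n; rewrite geometric_ge0//; lra.
- by move=> n; rewrite /geometric /= (le_trans (u_le n))//; lra.
- by apply: is_cvg_geometric_series; rewrite ger0_norm; lra.
Qed.

Lemma lim_series_two_thirds_dist N :
  `|limn (series u) - series u N| <= (2 / 3) ^+ N.
Proof.
have cu := cvg_series_two_thirds.
apply: (cvgr_to_le (cvg_norm (cvgB cu (cvg_cst (series u N))))).
exists N => // M /= NM.
rewrite (le_trans (series_two_thirds_dist NM))//.
by rewrite lerBlDr lerDl exprn_ge0//; lra.
Qed.

Lemma lim_series_two_thirds_le1 : `|limn (series u)| <= 1.
Proof.
have := lim_series_two_thirds_dist 0.
by rewrite /series /= big_geq// subr0 expr0.
Qed.

End geometric_two_thirds.

(** * Iterated separation on [A] *)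

Lemma indic_cases (R : realType) (T : Type) (H : set T) x :
  (H x /\ \1_H x = 1 :> R) \/ (~ H x /\ \1_H x = 0 :> R).
Proof.
rewrite indicE; have [Hx|nHx] := pselect (H x); first by left; rewrite mem_set.
by right; rewrite memNset.
Qed.

Lemma cvg_expr_two_thirds (R : realType) :
  ((2 / 3 : R) ^+ n) @[n --> \oo] --> (0 : R).
Proof. by apply: cvg_expr; rewrite ger0_norm; lra. Qed.

(** Intersecting with [A] lets the remainders be total functions on [T] of which only the values on
    [A] matter. *)
Definition Gdelta_levels (R : realType) (T : topologicalType) (A : set T)
    (g : T -> R) := forall a,
  Gdelta (A `&` [set x | a <= g x]) /\ Gdelta (A `&` [set x | g x <= a]).

(** The subtracted function is constant on [H] and on its complement, both G_delta, so each level
    set is a union of two pieces cut from level sets of [g] at shifted thresholds. *)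
Lemma Gdelta_levels_indic (R : realType) (T : topologicalType) (A H : set T)
    (g : T -> R) (d e : R) :
  Fsigma H -> Gdelta H -> Gdelta_levels A g ->
  Gdelta_levels A (fun x => g x - d * (e - \1_H x)).
Proof.
move=> FH GH gA a.
have {}FH : Gdelta (~` H) by exact/Gdelta_setC.
have GU := Gdelta_setU (Gdelta_setI _ _) (Gdelta_setI FH _).
split.
  rewrite (_ : _ `&` _ = (H `&` (A `&` [set x | a + d * (e - 1) <= g x])) `|`
     (~` H `&` (A `&` [set x | a + d * e <= g x]))).
    by apply: GU => //; apply: (gA _).1.
  apply/seteqP; split=> x /=.
    by case: (indic_cases R H x) => -[Hx ->] [Ax ?]; [left|right];
    do ?split => //; lra.
  by case: (indic_cases R H x) => -[Hx ->] [] [? [Ax ?]] //; split=> //; lra.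
rewrite (_ : _ `&` _ = (H `&` (A `&` [set x | g x <= a + d * (e - 1)])) `|`
   (~` H `&` (A `&` [set x | g x <= a + d * e]))).
  by apply: GU => //; apply: (gA _).2.
apply/seteqP; split=> x /=.
  by case: (indic_cases R H x) => -[Hx ->] [Ax ?]; [left|right];
    do ?split => //; lra.
by case: (indic_cases R H x) => -[Hx ->] [] [? [Ax ?]] //; split=> //; lra.
Qed.

Lemma Gdelta_levels_step (R : realType) (T : topologicalType) (A : set T)
    (g : T -> R) (c : R) :
  perfectly_normal_space T -> Gdelta_levels A g -> 0 < c ->
  exists H : set T, [/\ Fsigma H, Gdelta H & forall x, A x -> `|g x| <= c ->
    `|g x - c * (2 / 3) * (1 / 2 - \1_H x)| <= c * (2 / 3)].
Proof.
move=> pT gA c0.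
have [|H [FH GH PH HQ]] :=
    Gdelta_separation pT (gA (- (c / 3))).2 (gA (c / 3)).1.
  by apply/seteqP; split=> // x [] /= [Ax g1] [_ g2]; lra.
exists H; split=> // x Ax; rewrite !ler_norml => /andP[g1 g2].
(* On [H], c/3 is added to a value below c/3; off [H], c/3 is subtracted from a value above -c/3. *)
case: (indic_cases R H x) => -[Hx ->].
  have : ~ (c / 3 <= g x) by move=> gc; apply: (HQ _ Hx).
  by move=> /negP; rewrite -ltNge => ?; apply/andP; split; lra.
have : ~ (g x <= - (c / 3)) by move=> gc; apply/Hx/PH.
by move=> /negP; rewrite -ltNge => ?; apply/andP; split; lra.
Qed.

Lemma Gdelta_levels_approx (R : realType) (T : topologicalType) (A : set T)
    (g : T -> R) (c : R) :
  perfectly_normal_space T -> Gdelta_levels A g -> 0 < c ->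
  (forall x, A x -> `|g x| <= c) ->
  exists H : nat -> set T, (forall n, Fsigma (H n) /\ Gdelta (H n)) /\
    forall x, A x -> forall N,
      `|g x - c * series (fun n => (2 / 3) ^+ n.+1 * (1 / 2 - \1_(H n) x)) N|
        <= c * (2 / 3) ^+ N.
Proof.
move=> pT gA c0 gc.
(* The separating set is chosen for every pair (function, bound), with a vacuous [set0] where the
   hypotheses fail, so that the remainders [r n] can be defined by plain recursion. *)
have /choice[sel selP] (hd : (T -> R) * R) : exists H : set T,
    Gdelta_levels A hd.1 -> 0 < hd.2 ->
    [/\ Fsigma H, Gdelta H & forall x, A x -> `|hd.1 x| <= hd.2 ->
      `|hd.1 x - hd.2 * (2 / 3) * (1 / 2 - \1_H x)| <= hd.2 * (2 / 3)].
  have [[h1 h2]|h] := pselect (Gdelta_levels A hd.1 /\ 0 < hd.2).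
    by have [H ?] := Gdelta_levels_step pT h1 h2; exists H.
  by exists set0 => ? ?; case: h.
pose d n : R := c * (2 / 3) ^+ n.
pose r := fix r n : T -> R := if n is n.+1 then
  fun x => r n x - d n * (2 / 3) * (1 / 2 - \1_(sel (r n, d n)) x) else g.
have d0 n : 0 < d n by rewrite mulr_gt0// exprn_gt0//; lra.
have rP n : Gdelta_levels A (r n) /\ (forall x, A x -> `|r n x| <= d n).
  elim: n => [|n [gr rd]]; first by split=> // x /gc; rewrite /d expr0 mulr1.
  have [FH GH rH] := selP (r n, d n) gr (d0 n); split.
    exact: Gdelta_levels_indic.
  move=> x Ax; have -> : d n.+1 = d n * (2 / 3) by rewrite /d exprSr; lra.
  by apply: rH => //; exact: rd.
exists (fun n => sel (r n, d n)); split=> [n|x Ax N].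
  by have [gr _] := rP n; have [] := selP (r n, d n) gr (d0 n).
rewrite (_ : _ - _ = r N x); first exact: (rP N).2.
elim: N => [|N /= <-]; first by rewrite /series/= big_geq// mulr0 subr0.
by rewrite seriesSr /d exprSr; lra.
Qed.

(** * The Baire class of the series *)

(** Allowing any [w] in [0, 1] covers both the characteristic functions and their continuous
    approximants. *)
Lemma two_thirds_term_le (R : realType) (w : R) n : 0 <= w <= 1 ->
  `|(2 / 3) ^+ n.+1 * (1 / 2 - w)| <= (2 / 3) ^+ n / 3.
Proof.
move=> w01; have p0 : 0 <= (2 / 3 : R) ^+ n by rewrite exprn_ge0//; lra.
rewrite exprS normrM ger0_norm; last by rewrite mulr_ge0//; lra.
have : `|1 / 2 - w| <= 1 / 2 by rewrite ler_norml; lra.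
by move/(ler_wpM2l p0); lra.
Qed.

Lemma indic_two_thirds_le (R : realType) (T : Type) (H : nat -> set T) x n :
  `|(2 / 3) ^+ n.+1 * (1 / 2 - \1_(H n) x)| <= (2 / 3 : R) ^+ n / 3.
Proof.
by apply: two_thirds_term_le; case: (indic_cases R (H n) x) => -[_ ->]; lra.
Qed.

(* Diagonal approximation: the [k]-th approximant uses the first [k] terms, each
   with the [k]-th continuous approximant of its characteristic function. *)
Lemma baire_one_series_indic (R : realType) (T : topologicalType)
    (H : nat -> set T) :
  normal_space T -> (forall n, Fsigma (H n) /\ Gdelta (H n)) ->
  baire_one (fun x : T =>
    limn (series (fun n => (2 / 3 : R) ^+ n.+1 * (1 / 2 - \1_(H n) x)))).
Proof.
move=> nT HFG.
have /choice[w wP] n : exists w : nat -> T -> R, [/\ forall k, continuous (w k),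
    forall k x, 0 <= w k x <= 1 &
    forall x, w k x @[k --> \oo] --> (\1_(H n) x : R)].
  by have [FH GH] := HFG n; exact: indic_baire_one.
pose v k x n : R := (2 / 3) ^+ n.+1 * (1 / 2 - w n k x).
have vP k x n : `|v k x n| <= (2 / 3) ^+ n / 3.
  by apply: two_thirds_term_le; have [_ + _] := wP n; apply.
exists (fun k x => series (v k x) k) => [k|x].
  suff cS m : continuous (fun x => series (v k x) m) by exact: cS.
  elim: m => [|m IH] x.
    by rewrite /series/=; under eq_fun do rewrite big_geq//; exact: cvg_cst.
  under eq_fun do rewrite seriesSr.
  apply: cvgD; first exact: IH.
  apply: cvgM; first exact: cvg_cst.
  apply: cvgB; first exact: cvg_cst.
  by have [cw _ _] := wP m; exact: cw.
pose u n : R := (2 / 3) ^+ n.+1 * (1 / 2 - \1_(H n) x); rewrite -/u.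
have uP n : `|u n| <= (2 / 3) ^+ n / 3 by exact: indic_two_thirds_le.
have vu N : series (v k x) N @[k --> \oo] --> series u N.
  elim: N => [|N IH].
    rewrite {2}/series/= big_geq//.
    by rewrite /series/=; under eq_fun do rewrite big_geq//; exact: cvg_cst.
  rewrite seriesSr; under eq_fun do rewrite seriesSr.
  apply: cvgD; first exact: IH.
  apply: cvgM; first exact: cvg_cst.
  apply: cvgB; first exact: cvg_cst.
  by have [_ _ cw] := wP N; exact: cw.
apply/cvgrPdist_lt => e e0.
have e30 : 0 < e / 3 by lra.
(* Three errors below e/3: the tails past [N] of the series and of the approximant, the latter
   bounded uniformly in [k], and the first [N] terms, where [k] grows with [N] fixed. *)
have [N _ /(_ N (leqnn N)) /= eN] := cvgr_lt _ (@cvg_expr_two_thirds R) _ e30.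
have [K _ KP] := cvgr_dist_lt _ _ (vu N) _ e30.
exists (maxn K N) => // k /=; rewrite geq_max => /andP[Kk Nk].
have h1 := lim_series_two_thirds_dist uP N.
have h2 := KP k Kk.
have h3 := series_two_thirds_dist (vP k x) Nk.
have p0 : 0 <= (2 / 3 : R) ^+ k by rewrite exprn_ge0//; lra.
rewrite distrC in h3.
have -> : limn (series u) - series (v k x) k =
  (limn (series u) - series u N) + (series u N - series (v k x) N)
   + (series (v k x) N - series (v k x) k) by lra.
set a := limn _ - _ in h1 *; set b := series u N - _ in h2 *.
set d := _ - series (v k x) k in h3 *.
have := ler_normD (a + b) d; have := ler_normD a b.
by lra.
Qed.

(** * Extension of bounded functions *)

Lemma cvg_uniform_dist (R : realType) (T : choiceType) (F : nat -> T -> R)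
    (g : T -> R) (e : nat -> R) :
  (forall N x, `|g x - F N x| <= e N) -> e n @[n --> \oo] --> (0 : R) ->
  {uniform, F @ \oo --> g}.
Proof.
move=> Fg e0; move=> P /uniform_nbhs[E [entE EP]].
move: entE; rewrite -entourage_ballE => -[d /= d0 dE].
have [N0 _ NP] := cvgr_lt _ e0 d d0; exists N0 => // N /NP /= eN.
apply: EP => y _; apply: dE => /=.
by rewrite /ball /=; apply: le_lt_trans eN.
Qed.

Lemma sup_norm_leP (R : realType) (T : Type) (g : T -> R) (c : R) :
  (sup_norm g <= c%:E)%E <-> forall x, `|g x| <= c.
Proof.
split=> [/ereal_supP gc x|gc]; first by rewrite -lee_fin; apply: gc; exists x.
by apply/ereal_supP => _ [x _ <-]; rewrite lee_fin.
Qed.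

Lemma sup_norm_le_extension (R : realType) (T : Type) (A : set T)
    (f : A -> R) (g : T -> R) :
  (forall x : A, g (set_val x) = f x) -> (sup_norm f <= sup_norm g)%E.
Proof.
move=> gf; apply: ereal_sup_le => _ [x _ <-].
by exists (set_val x) => //; rewrite gf.
Qed.

Lemma bounded_baire_extension (R : realType) (Omega : topologicalType)
    (HOmega : perfectly_normal_space Omega)
    (A : set Omega) (A_neq0 : A !=set0) (A_Gdelta : Gdelta A)
    (f : A -> R) (f_baire : baire_one f) (c : R) :
  sup_norm f = c%:E ->
  exists H : nat -> set Omega,
    (forall n, Fsigma (H n) /\ Gdelta (H n)) /\
    let u (x : Omega) (n : nat) : R :=
      (2 / 3) ^+ n.+1 * (1 / 2 - \1_(H n) x) in
    let fbar (x : Omega) : R := c * limn (series (u x)) in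
    [/\ {uniform, (fun (N : nat) (x : Omega) => c * series (u x) N)
           @ \oo --> fbar},
        baire_one fbar,
        forall x : A, fbar (set_val x) = f x &
        sup_norm fbar = c%:E].
Proof.
move=> fc; have fle : forall x, `|f x| <= c by apply/sup_norm_leP; rewrite fc.
have c0 : 0 <= c.
  by have [a /mem_set Aa] := A_neq0; exact: le_trans (fle (SigSub Aa)).
pose f0 (x : Omega) : R := oapp f 0 (insub x).
have f0E (x : A) : f0 (set_val x) = f x by rewrite /f0 valK.
have inA x : A x -> exists y : A, set_val y = x.
  by move=> /mem_set Ax; exists (SigSub Ax).
have f0A : Gdelta_levels A f0.
  move=> a; split.
    have := Gdelta_set_val A_Gdelta (baire_one_ge_Gdelta a f_baire).
    congr Gdelta; apply/seteqP; split=> [_ [x /= ax <-]|x [/inA[y <-]]].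
      by split; [exact: set_valP|rewrite /= f0E].
    by rewrite /= f0E; exists y.
  have := Gdelta_set_val A_Gdelta (baire_one_le_Gdelta a f_baire).
  congr Gdelta; apply/seteqP; split=> [_ [x /= ax <-]|x [/inA[y <-]]].
    by split; [exact: set_valP|rewrite /= f0E].
  by rewrite /= f0E; exists y.
have f0c x : A x -> `|f0 x| <= c by move=> /inA[y <-]; rewrite f0E.
have [H [HFG HA]] : exists H : nat -> set Omega,
    (forall n, Fsigma (H n) /\ Gdelta (H n)) /\
    forall x, A x -> forall N,
      `|f0 x - c * series (fun n => (2 / 3) ^+ n.+1 * (1 / 2 - \1_(H n) x)) N|
        <= c * (2 / 3) ^+ N.
  (* Separation needs [0 < c]; if [c] is 0, then [f0] vanishes on [A] and empty sets serve. *)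
  move: c0; rewrite le_eqVlt => /predU1P[c0|c0]; last first.
    exact: Gdelta_levels_approx.
  exists (fun=> set0); split=> [_|x Ax N].
    by split; [exact/closed_Fsigma/closed0|exact/open_Gdelta/open0].
  by rewrite -c0 !mul0r subr0 c0; exact: f0c.
exists H; split=> // u fbar.
have uP x n : `|u x n| <= (2 / 3) ^+ n / 3 by exact: indic_two_thirds_le.
have fbarE x N : `|fbar x - c * series (u x) N| <= c * (2 / 3) ^+ N.
  rewrite -mulrBr normrM (ger0_norm c0) ler_wpM2l//.
  exact: lim_series_two_thirds_dist.
have cgeo : (c * (2 / 3) ^+ n) @[n --> \oo] --> (0 : R).
  rewrite -(mulr0 c); apply: cvgM; first exact: cvg_cst.
  exact: cvg_expr_two_thirds.
have ext (x : A) : fbar (set_val x) = f x.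
  (* Both sides are limits of the same partial sums, with error at most c (2/3)^N. *)
  apply: (@cvg_unique _ (@Rhausdorff R)
    (c * series (u (set_val x)) n @[n --> \oo])).
    apply/cvgrPdist_le => e e0; have [N _ NP] := cvgr_lt _ cgeo e e0.
    by exists N => // n /NP /= ?; rewrite (le_trans (fbarE _ _))// ltW.
  apply/cvgrPdist_le => e e0; have [N _ NP] := cvgr_lt _ cgeo e e0.
  exists N => // n /NP /= ?; rewrite -f0E (le_trans (HA _ (set_valP x) _))//.
  exact: ltW.
split=> //.
- exact: cvg_uniform_dist cgeo.
- have [v cv vf] := @baire_one_series_indic R _ _ HOmega.1 HFG.
  exists (fun n x => c * v n x) => [n x|x].
    by apply: cvgM; [exact: cvg_cst|exact: cv].
  by apply: cvgM; [exact: cvg_cst|exact: vf].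
- apply/eqP; rewrite eq_le -{2}fc sup_norm_le_extension// andbT.
  apply/sup_norm_leP => x; rewrite normrM (ger0_norm c0) ler_piMr//.
  exact: lim_series_two_thirds_le1.
Qed.

(** * Extension of unbounded functions *)

Lemma baire_one_squash (R : realType) (T : topologicalType) (f : T -> R) :
  baire_one f -> baire_one (fun x => f x / (1 + `|f x|)).
Proof.
have f1 (y : R) : 1 + `|y| != 0 by rewrite gt_eqF// ltr_pwDl.
move=> [u cu uf]; exists (fun n x => u n x / (1 + `|u n x|)) => [n x|x].
  apply: cvgM; first exact: cu.
  apply: cvgV; first exact: f1.
  by apply: cvgD; [exact: cvg_cst|apply: cvg_norm; exact: cu].
apply: cvgM; first exact: uf.
apply: cvgV; first exact: f1.
by apply: cvgD; [exact: cvg_cst|apply: cvg_norm; exact: uf].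
Qed.

(** The approximants [u k] may leave (-1, 1), so the denominator is kept at least 1/(k+1); at each
    point this floor is eventually inactive because [1 - |s x|] is positive. *)
Lemma baire_one_unsquash (R : realType) (T : topologicalType) (s : T -> R) :
  baire_one s -> (forall x, `|s x| < 1) ->
  baire_one (fun x => s x / (1 - `|s x|)).
Proof.
move=> [u cu us] s1.
exists (fun k x => u k x / Num.max (1 - `|u k x|) k.+1%:R^-1) => [k x|x].
  apply: cvgM; first exact: cu.
  apply: cvgV; first by rewrite gt_eqF// lt_max invr_gt0 ltr0n orbT.
  apply: (@continuous_max _ _ (fun y => 1 - `|u k y|) (cst k.+1%:R^-1)).
    by apply: cvgB; [exact: cvg_cst|apply: cvg_norm; exact: cu].
  exact: cvg_cst.
have sx : 0 < 1 - `|s x| by rewrite subr_gt0.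
have cn : (1 - `|u k x|) @[k --> \oo] --> 1 - `|s x|.
  by apply: cvgB; [exact: cvg_cst|apply: cvg_norm; exact: us].
have sx2 : 0 < (1 - `|s x|) / 2 by rewrite divr_gt0.
have [|N1 _ P1] := cvgr_gt _ cn ((1 - `|s x|) / 2); first lra.
have [N2 _ P2] := near_infty_natSinv_lt (PosNum sx2).
apply: cvgM; first exact: us.
apply: cvgV; first by rewrite gt_eqF.
apply: cvg_trans cn; apply: near_eq_cvg.
exists (maxn N1 N2) => // k /=; rewrite geq_max => /andP[k1 k2].
apply/esym/max_idPl/ltW; apply: lt_trans (P1 k k1); exact: (P2 k k2).
Qed.

(* [f] is squashed into (-1, 1) by t / (1 + |t|); multiplying the bounded
   extension by the characteristic function of an ambiguous set separating [A]
   from the points where it leaves (-1, 1) makes it possible to undo this. *)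
Lemma unbounded_baire_extension (R : realType) (Omega : topologicalType)
    (HOmega : perfectly_normal_space Omega)
    (A : set Omega) (A_neq0 : A !=set0) (A_Gdelta : Gdelta A)
    (f : A -> R) (f_baire : baire_one f) :
  exists fbar : Omega -> R,
    baire_one fbar /\ forall x : A, fbar (set_val x) = f x.
Proof.
have f1 x : 0 < 1 + `|f x| by rewrite ltr_pwDl.
pose g x : R := f x / (1 + `|f x|).
have normg x : `|g x| = `|f x| / (1 + `|f x|).
  by rewrite normrM normfV (gtr0_norm (f1 x)).
have g1 x : `|g x| < 1 by rewrite normg ltr_pdivrMr// mul1r ltrDr.
have bg : baire_one g by exact: baire_one_squash.
(* The bounded case takes a real norm: a point of [A] excludes -oo, and the bound 1 excludes +oo. *)
have gfin : sup_norm g \is a fin_num.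
  rewrite fin_numElt; apply/andP; split.
    have [a /mem_set Aa] := A_neq0.
    apply: (@lt_le_trans _ _ (`|g (SigSub Aa)|%:E)); first exact: ltNyr.
    by apply: ereal_sup_ubound; exists (SigSub Aa).
  apply: (@le_lt_trans _ _ 1%:E); last exact: ltry.
  by apply/sup_norm_leP => x; exact: ltW.
have [gbar bG Gg] : exists2 gbar : Omega -> R,
    baire_one gbar & forall x : A, gbar (set_val x) = g x.
  have [G [_ [_ bG Gg _]]] :=
    bounded_baire_extension HOmega A_neq0 A_Gdelta bg (esym (fineK gfin)).
  by exact: ex_intro2 bG Gg.
have [|H [FH GH AH HZ]] := Gdelta_separation HOmega A_Gdelta
    (Gdelta_setU (baire_one_ge_Gdelta 1 bG) (baire_one_le_Gdelta (- 1) bG)).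
  apply/seteqP; split=> // x [/mem_set Ax].
  have := g1 (SigSub Ax); rewrite -Gg -[set_val _]/x ltr_norml => /andP[? ?] Z.
  exfalso.
  by case: Z => /= ?; lra.
pose s x : R := gbar x * \1_H x.
have s1 x : `|s x| < 1.
  rewrite /s; case: (indic_cases R H x) => -[Hx ->]; last first.
    by rewrite mulr0 normr0.
  have /not_orP[/= /negP + /negP] := HZ _ Hx.
  by rewrite -!ltNge mulr1 ltr_norml => -> ->.
have bs : baire_one s.
  have [u cu ug] := bG; have [w [cw _ wH]] := indic_baire_one R HOmega.1 FH GH.
  exists (fun n x => u n x * w n x) => [n x|x].
    by apply: cvgM; [exact: cu|exact: cw].
  by apply: cvgM; [exact: ug|exact: wH].
exists (fun x => s x / (1 - `|s x|)); split; first exact: baire_one_unsquash.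
(* On [A] the factor [\1_H] is 1, and 1 - |g| = 1/(1 + |f|), so the division recovers [f]. *)
move=> x; have -> : s (set_val x) = g x.
  by rewrite /s Gg indicE mem_set ?mulr1//; apply: AH; exact: set_valP.
rewrite normg /g; have := f1 x; move: `|f x| => t t0.
have -> : 1 - t / (1 + t) = (1 + t)^-1 by field; rewrite gt_eqF.
by rewrite invrK divfK// gt_eqF.
Qed.

(* [A], used as a type, is the subtype with the subspace (initial) topology. *)
Theorem theorem3p2 (R : realType) (Omega : topologicalType)
    (HOmega : perfectly_normal_space Omega)
    (A : set Omega) (A_neq0 : A !=set0) (A_Gdelta : Gdelta A)
    (f : A -> R) (f_baire : baire_one f) :
  (exists fbar : Omega -> R,
     [/\ baire_one fbar,
         forall x : A, fbar (set_val x) = f x &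
         sup_norm f = sup_norm fbar]) /\
  (forall c : R, sup_norm f = c%:E ->
     exists H : nat -> set Omega,
       (forall n, Fsigma (H n) /\ Gdelta (H n)) /\
       let u (x : Omega) (n : nat) : R :=
         (2 / 3) ^+ n.+1 * (1 / 2 - \1_(H n) x) in
       let fbar (x : Omega) : R := c * limn (series (u x)) in
       [/\ {uniform, (fun (N : nat) (x : Omega) => c * series (u x) N)
             @ \oo --> fbar},
           baire_one fbar,
           forall x : A, fbar (set_val x) = f x &
           sup_norm fbar = c%:E]).
Proof.
split; last by move=> c; exact: bounded_baire_extension.
(* If the norm is +oo, any Baire-one extension works, since extending cannot lower it; -oo is
   excluded by a point of [A]. *)
case fc : (sup_norm f) => [c| |].
- have [H [_ [_ bf ext supf]]] :=
    bounded_baire_extension HOmega A_neq0 A_Gdelta f_baire fc.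
  by eexists; split; [exact: bf|exact: ext|].
- have [fbar [bf ext]] :=
    unbounded_baire_extension HOmega A_neq0 A_Gdelta f_baire.
  exists fbar; split=> //; apply/esym/eqP.
  by rewrite -leye_eq -fc; exact: sup_norm_le_extension.
- have [a /mem_set Aa] := A_neq0.
  have : (`|f (SigSub Aa)|%:E <= sup_norm f)%E.
    by apply: ereal_sup_ubound; exists (SigSub Aa).
  by rewrite fc.
Qed.
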